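(* Fix $n\ge 2$. For each $s\geq 1$ let $P_1,\ldots,P_s\in\mathbb{R}[x_0,\ldots,x_n]$ be independent homogeneous Kostlan quadrics (Kostlan polynomials of degree $2$). Let $\Gamma_i\subset\mathbb{R}\mathrm{P}^n$ be the (possibly empty) zero set of $P_i$ and let $\Gamma=\bigcup_{i=1}^s\Gamma_i$. Then $$\lim_{s\to\infty}\frac{\mathbb{E}[b_0(\Gamma)]}{s}=0.$$
   Context: A Kostlan polynomial of degree $d$ in $n+1$ variables is the random homogeneous polynomial $$P(x)=\sum_{\alpha_0+\cdots+\alpha_n=d}\xi_\alpha\,x_0^{\alpha_0}\cdots x_n^{\alpha_n},$$ where the coefficients $\xi_\alpha$ are independent centered real Gaussian random variables with variance $\frac{d!}{\alpha_0!\cdots\alpha_n!}$. The number $b_0(\Gamma)$ is the number of connected components of $\Gamma$ (with $b_0(\emptyset)=0$). *)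

(* Defs.v *)
From HB Require Import structures.
From mathcomp Require Import all_boot all_order all_algebra generic_quotient finmap.
From mathcomp Require Import all_classical all_reals all_analysis.
(* The notations of mpoly clash with those of mathcomp-analysis. *)
From mathcomp Require Import (canonicals, coercions) mpoly.

Set Implicit Arguments.
Unset Strict Implicit.
Unset Printing Implicit Defensive.

Import Order.TTheory GRing.Theory Num.Theory.
Import numFieldNormedType.Exports.

Local Open Scope classical_set_scope.
Local Open Scope ring_scope.
Local Open Scope quotient_scope.

Section ProjectiveSpace.
Variables (R : realType) (n : nat).

Definition nonzero : set 'rV[R]_n.+1 := [set x | x != 0].

Definition same_line (x y : nonzero) : bool :=
  `[< exists2 c : R, c != 0 & set_val x = c *: set_val y >].

Lemma same_line_equiv : equiv_class_of same_line.
Proof.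
split=> [x|x y|y x z].
- by apply/asboolP; exists 1; rewrite ?oner_eq0 ?scale1r.
- by apply/asboolP/asboolP => -[c c0 ->]; exists c^-1;
    rewrite ?invr_eq0 // scalerA mulVf // scale1r.
- move=> /asboolP[a a0 xy] /asboolP[b b0 yz]; apply/asboolP; exists (a * b).
    by rewrite mulf_neq0.
  by rewrite xy yz scalerA.
Qed.

Canonical same_line_equiv_rel := EquivRelPack same_line_equiv.

Definition projective_space : topologicalType :=
  quotient_topology {eq_quot same_line_equiv_rel}.

Definition proj_class (x : nonzero) : projective_space :=
  \pi_{eq_quot same_line_equiv_rel} x.

(* Intended for homogeneous [p], whose vanishing at [x] depends only on the
   class of [x]. *)
Definition zero_locus (p : mpoly.mpoly n.+1 R) : set projective_space :=
  proj_class @`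
    [set x | mpoly.meval (fun i => (set_val x : 'rV[R]_n.+1) 0 i) p = 0].

End ProjectiveSpace.

Definition b0 (R : realType) (X : topologicalType) (A : set X) : \bar R :=
  counting (connected_component A @` A).

Section Probability.
Context d (T : measurableType d) (R : realType) (P : probability T R).

Definition mutually_independent (I : choiceType) (D : set I)
    (F : I -> set_system T) : Prop :=
  forall (J : {fset I}) (E : I -> set T), [set` J] `<=` D ->
    (forall i, i \in J -> F i (E i)) ->
    P (\bigcap_(i in [set` J]) E i) = (\prod_(i <- J) P (E i))%E.

Definition sigma_of (X : T -> R) : set_system T :=
  preimage_set_system setT X measurable.

(* [normal_prob] takes the standard deviation, not the variance. *)
Definition centered_gaussian (X : {RV P >-> R}) (v : R) : Prop :=
  forall A, measurable A -> distribution P X A = normal_prob 0 (Num.sqrt v) A.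

(* [mpoly.bmultinom n.+1 k.+1] is the finite type of exponents of total degree
   less than [k.+1]. *)
Definition kostlan (n k : nat) (p : T -> mpoly.mpoly n.+1 R) : Prop :=
  exists xi : mpoly.multinom n.+1 -> {RV P >-> R},
    [/\ mutually_independent [set a | mpoly.mdeg a = k]
          (fun a => sigma_of (xi a)),
        forall a, mpoly.mdeg a = k ->
          centered_gaussian (xi a) (k`!%:R / (\prod_i (a i)`!)%N%:R) &
        forall t, p t = \sum_(a : mpoly.bmultinom n.+1 k.+1 | mpoly.mdeg a == k)
          xi a t *: mpoly.mpolyX R a].

Definition sigma_of_poly (n : nat) (p : T -> mpoly.mpoly n R) : set_system T :=
  <<s \bigcup_a sigma_of (fun t => mpoly.mcoeff a (p t)) >>.

Definition independent_polys (n s : nat) (p : 'I_s -> T -> mpoly.mpoly n R) :=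
  mutually_independent setT (fun i => sigma_of_poly (p i)).

End Probability.

(* Main.v *)
(* For n >= 2 every quadric of RP^n is connected, so b0 of the union is at most
   the size of any set of indices such that each nonempty quadric meets one
   whose index is in the set. If a quadric y contains points near a and near b,
   and the form x is positive near a and negative near b, then x vanishes
   somewhere on the connected set y. Hence for each small cube of indefinite
   forms (in coefficient space) there is an open box of forms, the "hubs", whose
   quadrics meet every quadric of the cube. By independence, a hub of each of
   finitely many cubes is present except with exponentially small probability.
   The cubes of side h that contain neither only uniformly indefinite forms nor
   only rootless forms lie near the boundary of the semidefinite cones:
   translating one of them by a few steps in a positive definite direction makes
   all its forms definite. So a proportion O(h) of the cubes is bad. As Gaussian
   densities are bounded, all but a small proportion of the quadrics are then
   dominated by a bounded number of hubs. *)
Require Import Defs.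
From mathcomp Require Import all_boot all_order all_algebra generic_quotient finmap.
From mathcomp Require Import all_classical all_reals all_analysis.
From mathcomp Require Import measurable_realfun.
From mathcomp Require Import (canonicals, coercions) mpoly.
From mathcomp Require Import ring lra zify.
Import Order.TTheory GRing.Theory Num.Theory.
Import numFieldNormedType.Exports.
Local Open Scope classical_set_scope.
Local Open Scope ring_scope.
Set Implicit Arguments.
Unset Strict Implicit.
Unset Printing Implicit Defensive.

(** * Quadratic forms and curves on their zero cones *)

Section QuadraticForm.
Variables (R : realType) (m : nat) (I : finType) (f g : I -> 'I_m).
Implicit Types (c : I -> R) (u v w x y : 'rV[R]_m).

Definition qform c x := \sum_k c k * (x 0 (f k) * x 0 (g k)).

(** The polarization without the factor 1/2: q(u + v) = q(u) + q(v) + B(u, v), so B(u, u) = 2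
    q(u). *)
Definition polar c x y :=
  \sum_k c k * (x 0 (f k) * y 0 (g k) + y 0 (f k) * x 0 (g k)).

Lemma qform_lin3 c (r s t : R) u v w :
  qform c (r *: u + s *: v + t *: w) =
  r ^+ 2 * qform c u + s ^+ 2 * qform c v + t ^+ 2 * qform c w
  + r * s * polar c u v + r * t * polar c u w + s * t * polar c v w.
Proof.
rewrite /qform /polar !mulr_sumr -!big_split /=; apply: eq_bigr => k _.
by rewrite !mxE; ring.
Qed.

Lemma qform_lin2 c (r s : R) u v :
  qform c (r *: u + s *: v) =
  r ^+ 2 * qform c u + s ^+ 2 * qform c v + r * s * polar c u v.
Proof.
by rewrite -[_ + s *: v]addr0 -(scale0r u) qform_lin3; ring.
Qed.

Lemma qformZ c (r : R) u : qform c (r *: u) = r ^+ 2 * qform c u.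
Proof. by rewrite -[_ *: u]addr0 -(scale0r u) qform_lin2; ring. Qed.

Lemma qform0 c : qform c 0 = 0.
Proof. by rewrite /qform big1 // => k _; rewrite !mxE; ring. Qed.

Lemma polar_lin c u (r s : R) v w :
  polar c u (r *: v + s *: w) = r * polar c u v + s * polar c u w.
Proof.
rewrite /polar !mulr_sumr -!big_split /=; apply: eq_bigr => k _.
by rewrite !mxE; ring.
Qed.

Lemma polarC c u v : polar c u v = polar c v u.
Proof. by apply: eq_bigr => k _; ring. Qed.

Lemma polar0 c u : polar c u 0 = 0.
Proof. by rewrite /polar big1 // => k _; rewrite !mxE; ring. Qed.

Lemma polarE c u v : polar c u v = \sum_i v 0 i * polar c u (delta_mx 0 i).
Proof.
rewrite [in LHS](row_sum_delta v).
have polarD : {morph polar c u : x y / x + y >-> x + y}.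
  by move=> x y; rewrite -(scale1r x) -(scale1r y) polar_lin !scale1r !mul1r.
rewrite (big_morph _ polarD (polar0 c u)); apply: eq_bigr => i _.
rewrite -[X in polar c u X]addr0 -(scale0r 0) polar_lin polar0.
by rewrite mulr0 addr0.
Qed.

(** Polarity to u and to v amounts to two linear conditions, which have a nonzero common solution in
    more than two coordinates. The dimension hypothesis enters the proof here. *)
Lemma polar_common_kernel c u v : (2 < m)%N ->
  exists w, [/\ w != 0, polar c u w = 0 & polar c v w = 0].
Proof.
move=> m_gt2.
pose A : 'M[R]_(m, 2) :=
  \matrix_(i, j) polar c (if j == 0 then u else v) (delta_mx 0 i).
have kerA : kermx A != 0.
  rewrite -mxrank_eq0 mxrank_ker subn_eq0 -ltnNge.
  exact: leq_ltn_trans (rank_leq_col A) m_gt2.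
have [w wA w0] := elimTF rowV0Pn kerA.
exists w; split => //; move/sub_kermxP : wA => /rowP wA.
- rewrite polarE; transitivity ((w *m A) 0 0); last by rewrite wA mxE.
  by rewrite mxE; apply: eq_bigr => i _; rewrite mxE.
- rewrite polarE; transitivity ((w *m A) 0 1); last by rewrite wA mxE.
  by rewrite mxE; apply: eq_bigr => i _; rewrite mxE.
Qed.

Definition isotropic c : set 'rV[R]_m := [set x | x != 0 /\ qform c x = 0].

(** Paths are defined on all of R and stay in Z throughout, so that their continuity is the plain
    one; only the part over [0, 1] matters later. *)
Definition joined (Z : set 'rV[R]_m) u v :=
  exists z : R -> 'rV[R]_m,
    [/\ continuous z, z 0 = u, z 1 = v & forall t, Z (z t)].

Lemma joined_refl (Z : set 'rV[R]_m) u : Z u -> joined Z u u.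
Proof. by move=> Zu; exists (cst u); split => //; exact: cst_continuous. Qed.

Definition independent u v :=
  forall r s : R, r *: u + s *: v = 0 -> r = 0 /\ s = 0.

Lemma proportional_or_independent u v : u != 0 -> v != 0 ->
  (exists2 s : R, s != 0 & u = s *: v) \/ independent u v.
Proof.
move=> u0 v0.
have [[s us]|nus] := pselect (exists s : R, u = s *: v).
  by left; exists s => //; apply: contra_neq u0 => s0; rewrite us s0 scale0r.
right => r s rs; have [r0|r0] := eqVneq r 0.
  split=> //; apply/eqP; move: rs; rewrite r0 scale0r add0r => /eqP.
  by rewrite scaler_eq0 (negbTE v0) orbF.
case: nus; exists (- (s / r)); apply: (scalerI r0).
rewrite scalerA mulrN mulrCA divff // mulr1 scaleNr.
by apply/eqP; rewrite -addr_eq0 rs.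
Qed.

Lemma continuous_lin3 (a b d : R -> R) u v w :
  continuous a -> continuous b -> continuous d ->
  continuous (fun t => a t *: u + b t *: v + d t *: w).
Proof.
move=> ac bc dc t; apply: cvgD; first apply: cvgD.
- by apply: cvgZr_tmp; exact: ac.
- by apply: cvgZr_tmp; exact: bc.
- by apply: cvgZr_tmp; exact: dc.
Qed.

(** The form vanishes on the whole span of u and v, and independence keeps the segment away from
    0. *)
Lemma joined_segment c u v : independent u v ->
  qform c u = 0 -> qform c v = 0 -> polar c u v = 0 ->
  joined (isotropic c) u v.
Proof.
move=> uv qu qv puv.
exists (fun t => (1 - t) *: u + t *: v + 0 *: v); split.
- by apply: continuous_lin3 => t; [apply: cvgB; [exact: cvg_cst|exact: cvg_id]
    | exact: cvg_id | exact: cvg_cst].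
- by rewrite subr0 scale1r !scale0r !addr0.
- by rewrite subrr scale1r !scale0r addr0 add0r.
- move=> t; split; last by rewrite qform_lin3 qu qv puv; ring.
  apply/eqP; rewrite scale0r addr0 => /uv[t1 t0].
  by move: t1; rewrite t0 subr0 => /eqP; rewrite oner_eq0.
Qed.

(* The curve (1-t)^2 u + sg t^2 v + al t(1-t) w, with w polar to u and v, stays
   on the cone as soon as al^2 q(w) = - sg B(u, v). *)
Lemma joined_conic c u v w (sg al : R) : sg != 0 ->
  qform c u = 0 -> qform c v = 0 -> polar c u v != 0 ->
  polar c u w = 0 -> polar c v w = 0 ->
  al ^+ 2 * qform c w = - (sg * polar c u v) ->
  joined (isotropic c) u (sg *: v).
Proof.
move=> sg0 qu qv puv puw pvw hal.
exists (fun t => (1 - t) ^+ 2 *: u + (sg * t ^+ 2) *: v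
                 + (al * (t * (1 - t))) *: w); split.
- have id_c : continuous (fun t : R => t) by move=> t; exact: cvg_id.
  have sub_c : continuous (fun t : R => 1 - t).
    by move=> t; apply: cvgB; [exact: cvg_cst|exact: cvg_id].
  apply: continuous_lin3 => t.
  + by apply: cvgM; exact: sub_c.
  + by apply: cvgM; [exact: cvg_cst|apply: cvgM; exact: id_c].
  + by apply: cvgM; [exact: cvg_cst|apply: cvgM; [exact: id_c|exact: sub_c]].
- by rewrite subr0 expr0n /= !(mulr0, mul0r) !scale0r !addr0 expr1n scale1r.
- by rewrite subrr expr0n /= !mulr0 !scale0r !addr0 add0r expr1n mulr1.
- move=> t; split; last first.
    rewrite qform_lin3 qu qv puw pvw !mulr0 !addr0 !add0r.
    transitivity ((t * (1 - t)) ^+ 2 * (al ^+ 2 * qform c w + sg * polar c u v)).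
      by ring.
    by rewrite hal addNr mulr0.
  (* If the curve vanished at t, pairing with u would give t = 0, and pairing with v would then give
     B(u, v) = 0. *)
  apply/eqP => z0.
  have pz x : (1 - t) ^+ 2 * polar c x u + sg * t ^+ 2 * polar c x v
              + al * (t * (1 - t)) * polar c x w = 0.
    by rewrite -polar_lin -[X in X + _]mul1r -polar_lin scale1r z0 polar0.
  have quu : polar c u u = 0.
    by have := qform_lin2 c 1 1 u u; rewrite -scalerDl qformZ qu; lra.
  have qvv : polar c v v = 0.
    by have := qform_lin2 c 1 1 v v; rewrite -scalerDl qformZ qv; lra.
  have /eqP := pz u; rewrite quu puw !mulr0 add0r addr0.
  rewrite !mulf_eq0 (negbTE sg0) (negbTE puv) orbF /= => /orP[] /eqP t0;
  have /eqP := pz v; rewrite t0 qvv pvw polarC !mulr0 !addr0 subr0 expr1n mul1r;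
    by rewrite (negbTE puv).
Qed.

(** Projectively v and s v coincide, so a path may end at any nonzero multiple of v. If B(u, v) is
    nonzero, take w polar to both: for q(w) = 0 two segments through w suffice, otherwise a conic
    reaches v or - v. *)
Lemma isotropic_joined c u v : (2 < m)%N ->
  isotropic c u -> isotropic c v ->
  exists w, exists2 s : R, s != 0 &
    joined (isotropic c) u w /\ joined (isotropic c) w (s *: v).
Proof.
move=> m_gt2 [u0 qu] [v0 qv].
have joined_scale s : s != 0 -> joined (isotropic c) (s *: v) (s *: v).
  move=> s0; apply: joined_refl; split; last by rewrite qformZ qv mulr0.
  by rewrite scaler_eq0 negb_or s0.
have [[s s0 us]|uv] := proportional_or_independent u0 v0.
  by exists u, s => //; rewrite us; split; exact: joined_scale.
have [puv|puv] := eqVneq (polar c u v) 0.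
  exists v, 1; rewrite ?oner_eq0 //; split; first exact: joined_segment.
  by rewrite scale1r; exact: joined_refl.
have [w [w0 puw pvw]] := polar_common_kernel c u v m_gt2.
have [qw|qw] := eqVneq (qform c w) 0.
  exists w, 1; rewrite ?oner_eq0 // scale1r; split; apply: joined_segment => //.
  (* Pairing a relation between u and w with v isolates the coefficient of u, as B(v, w) = 0 and
     B(u, v) is nonzero. *)
  - move=> r s rs; have := polar_lin c v r s u w.
    rewrite rs polar0 pvw mulr0 addr0 polarC => /esym/eqP.
    rewrite mulf_eq0 (negbTE puv) orbF => /eqP r0; split=> //; apply/eqP.
    by move: rs; rewrite r0 scale0r add0r => /eqP;
       rewrite scaler_eq0 (negbTE w0) orbF.
  - move=> r s rs; have := polar_lin c u r s w v.
    rewrite rs polar0 puw mulr0 add0r => /esym/eqP.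
    rewrite mulf_eq0 (negbTE puv) orbF => /eqP s0; split=> //; apply/eqP.
    by move: rs; rewrite s0 scale0r addr0 => /eqP;
       rewrite scaler_eq0 (negbTE w0) orbF.
  - by rewrite polarC.
(* This sign makes - sg B(u, v) / q(w) equal to |B(u, v) / q(w)|, whose square root is the required
   al. *)
pose sg : R := - Num.sg (polar c u v / qform c w).
have sg0 : sg != 0 by rewrite oppr_eq0 sgr_eq0 mulf_neq0 ?invr_eq0.
exists (sg *: v), sg => //; split; last exact: joined_scale.
apply: (@joined_conic c u v w sg (Num.sqrt `|polar c u v / qform c w|)) => //.
by rewrite sqr_sqrtr // normrEsg -mulrA divfK // mulNr opprK.
Qed.

End QuadraticForm.

(** * Zero loci *)

Section ZeroLocus.
Variables (R : realType) (n : nat) (I : finType) (f g : I -> 'I_n.+1).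
Local Notation qform := (qform f g).
Local Notation isotropic := (isotropic f g).
Implicit Types (c : I -> R) (p : mpoly.mpoly n.+1 R).

Lemma continuous_monomial i j :
  continuous (fun x : 'rV[R]_n.+1 => x 0 i * x 0 j : R).
Proof.
have coordc k : continuous (fun x : 'rV[R]_n.+1 => x 0 k : R).
  exact: (@coord_continuous R 1 n.+1 0 k).
move=> x; apply: (@continuousM R _ (fun y : 'rV[R]_n.+1 => y 0 i : R)
  (fun y : 'rV[R]_n.+1 => y 0 j : R) x); exact: coordc.
Qed.

Lemma continuous_qform c : continuous (qform c).
Proof.
have sum_continuous := @continuous_big R I +%R 0 xpredT (@add_continuous R).
apply: sum_continuous => k _ x.
apply: (@continuousM R _ (fun y : 'rV[R]_n.+1 => c k) _ x).
  exact: cst_continuous.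
exact: continuous_monomial.
Qed.

Lemma joined_qform_root (Z : set 'rV[R]_n.+1) c u v : joined Z u v ->
  qform c u * qform c v <= 0 -> exists x, Z x /\ qform c x = 0.
Proof.
move=> [z [zc z0 z1 Zz]] quv.
have [||t _ qt] := @IVT R (qform c \o z) 0 1 0 ler01.
- by apply: continuous_subspaceT => t; apply: continuous_comp;
    [exact: zc|exact: continuous_qform].
- rewrite /= z0 z1 ge_min le_max.
  by have [] := lerP (qform c u) 0; have [] := lerP (qform c v) 0 => //=; nra.
- by exists (z t).
Qed.

(** The path from u to s v passes through some w. The first form has the same sign at s v as at v,
    so its sign at w decides on which leg the intermediate value theorem applies. *)
Lemma isotropic_meet c1 c2 u v : (2 <= n)%N ->
  isotropic c2 u -> isotropic c2 v -> 0 < qform c1 u -> qform c1 v < 0 ->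
  exists x, isotropic c1 x /\ isotropic c2 x.
Proof.
move=> n_ge2 Zu Zv u_gt0 v_lt0.
suff [x [[x0 qx] q1x]] : exists x, isotropic c2 x /\ qform c1 x = 0 by exists x.
have [w [s s0 [uw wv]]] := isotropic_joined (m := n.+1) n_ge2 Zu Zv.
have s2 : 0 < s ^+ 2 by rewrite exprn_even_gt0.
have [w_ge0|w_lt0] := lerP 0 (qform c1 w).
  apply: joined_qform_root wv _; rewrite qformZ.
  by rewrite mulr_ge0_le0 // mulr_ge0_le0 ?ltW.
by apply: joined_qform_root uw _; rewrite mulr_ge0_le0 ?ltW.
Qed.

(** Links a polynomial to a coefficient vector through values alone, so that the geometry never
    handles multinomials. *)
Definition evaluates_to p c :=
  forall x : 'rV[R]_n.+1, mpoly.meval (fun i => x 0 i) p = qform c x.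

Lemma proj_class_scale (x y : nonzero (R := R) (n := n)) (s : R) : s != 0 ->
  set_val x = s *: set_val y -> proj_class x = proj_class y.
Proof.
move=> s0 xy; have /eqmodP : same_line_equiv_rel R n x y.
  by apply/asboolP; exists s.
exact.
Qed.

Definition nonzero_point (x : 'rV[R]_n.+1) (x0 : x != 0) :
  nonzero (R := R) (n := n) := exist _ x (mem_set x0).

Lemma zero_locus_point p c (pc : evaluates_to p c) (x : nonzero (R := R) (n := n)) :
  isotropic c (set_val x) -> zero_locus p (proj_class x).
Proof. by move=> [_ qx]; exists x => //=; rewrite pc. Qed.

Lemma zero_locusP p c (pc : evaluates_to p c) X : zero_locus p X ->
  exists2 x : nonzero (R := R) (n := n), isotropic c (set_val x) & X = proj_class x.
Proof.
move=> [x /=]; rewrite pc => qx <-; exists x => //; split=> //.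
by have := set_valP x.
Qed.

Lemma joined_component p c (pc : evaluates_to p c)
    (x y : nonzero (R := R) (n := n)) :
  joined (isotropic c) (set_val x) (set_val y) ->
  connected_component (zero_locus p) (proj_class x) (proj_class y).
Proof.
move=> [z [zc z0 z1 Zz]].
pose zs t := nonzero_point (Zz t).1.
have zsc : continuous zs by apply: continuous_comp_initial; exact: zc.
have zs0 : zs 0 = x by apply: val_inj.
have zs1 : zs 1 = y by apply: val_inj.
pose C := (fun t => proj_class (zs t)) @` `[0, 1]%classic.
have C1 : C (proj_class y) by exists 1; rewrite ?zs1 //= in_itv /= ler01 lexx.
apply: connected_component_max C1.
- by exists 0; rewrite ?zs0 //= in_itv /= ler01 lexx.
- by move=> _ [t _ <-]; apply: (zero_locus_point pc); exact: Zz.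
- apply: connected_continuous_connected; first exact: segment_connected.
  apply: continuous_subspaceT => t.
  by apply: continuous_comp; [exact: zsc|exact: pi_continuous].
Qed.

(** Paths on the cone project to paths in the zero locus, where y and s y give the same point. *)
Lemma connected_zero_locus p c : evaluates_to p c -> (2 <= n)%N ->
  connected (zero_locus p).
Proof.
move=> pc n_ge2; have [->|/set0P[X pX]] := eqVneq (zero_locus p) classical_sets.set0.
  exact: connected0.
suff <- : connected_component (zero_locus p) X = zero_locus p.
  exact: component_connected.
apply/seteqP; split; first exact: connected_component_sub.
move=> Y pY; have [x Zx ->] := zero_locusP pc pX.
have [y Zy ->] := zero_locusP pc pY.
have [w [s s0 [xw wy]]] := isotropic_joined (m := n.+1) n_ge2 Zx Zy.
have w0 : w != 0 by have [z [_ <- _ Zz]] := wy; have [] := Zz 0.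
have sy0 : s *: set_val y != 0 by rewrite scaler_eq0 negb_or s0; case: Zy.
have <- : proj_class (nonzero_point sy0) = proj_class y.
  exact: (proj_class_scale s0).
by apply: (connected_component_trans (y := proj_class (nonzero_point w0)));
  exact: (joined_component pc).
Qed.

Lemma zero_locus_meet p1 p2 c1 c2 u v :
  evaluates_to p1 c1 -> evaluates_to p2 c2 -> (2 <= n)%N ->
  isotropic c2 u -> isotropic c2 v -> 0 < qform c1 u -> qform c1 v < 0 ->
  zero_locus p1 `&` zero_locus p2 !=set0.
Proof.
move=> pc1 pc2 n_ge2 Zu Zv u_gt0 v_lt0.
have [x [Z1x Z2x]] := isotropic_meet n_ge2 Zu Zv u_gt0 v_lt0.
exists (proj_class (nonzero_point Z1x.1)).
by split; [apply: (zero_locus_point pc1)|apply: (zero_locus_point pc2)].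
Qed.

End ZeroLocus.

(** * Counting components *)

Lemma b0_ge0 (R : realType) (X : topologicalType) (A : set X) : (0 <= b0 R A)%E.
Proof. by rewrite /b0 /counting; case: ifP; rewrite ?lee_fin ?leey. Qed.

Section DominatingSet.
Variables (R : realType) (X : topologicalType) (s : nat) (A : 'I_s -> set X).
Hypothesis A_connected : forall i, connected (A i).
Local Notation U := (\bigcup_(i in [set: 'I_s]) A i).

Lemma connected_component_bigcup i x y : A i x -> A i y ->
  connected_component U x = connected_component U y.
Proof.
move=> Ax Ay; apply: same_connected_component.
apply: (connected_component_max Ax) => // z Az; by exists i.
Qed.

(** Every component of the union contains some nonempty [A j] with j in D, and such an [A j]
    determines its component. *)
Lemma b0_dominating_set (D : {set 'I_s}) :
  (forall i x, A i x -> exists2 j, j \in D & A i `&` A j !=set0) ->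
  (b0 R U <= #|D|%:R%:E)%E.
Proof.
move=> dom.
(* The component containing [A j], written as a union over the points of [A j] so that no base point
   has to be chosen. *)
pose comp j := \bigcup_(y in A j) connected_component U y.
have compE j y : A j y -> connected_component U y = comp j.
  move=> Ay; apply/seteqP; split=> z; first by exists y.
  by move=> [y' Ay']; rewrite (connected_component_bigcup Ay Ay').
have sub : connected_component U @` U `<=` comp @` [set` D].
  move=> _ [x [i _ Ax] <-]; have [j jD [y [Aiy Ajy]]] := dom i x Ax.
  by exists j => //; rewrite -(compE j y) // (connected_component_bigcup Ax Aiy).
have fin : finite_set (connected_component U @` U).
  by apply: sub_finite_set sub _; apply: finite_image; exact: finite_finset.
rewrite /b0 /counting asboolT // lee_fin ler_nat.
rewrite cardE -(size_map comp); apply: uniq_leq_size; first exact: fset_uniq.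
move=> C; rewrite in_fset_set // inE => /sub[j jD <-].
by apply: map_f; rewrite mem_enum.
Qed.

End DominatingSet.

(** The K translates of B by 0, L, ..., (K - 1) L steps in direction e are pairwise disjoint and lie
    in a grid of side (2 + L) K. For fixed I and L, B thus contains only a proportion O(1/K) of the
    cells. *)
Lemma card_antichain_cells (I : finType) (e : I -> bool) (K L : nat)
    (B : {set {ffun I -> 'I_(2 * K)}}) : (0 < L)%N ->
  (forall j j' l, j \in B -> j' \in B -> (L <= l)%N ->
    ~ forall k, j k = (j' k + l * e k)%N :> nat) ->
  (#|B| * K <= ((2 + L) * K) ^ #|I|)%N.
Proof.
move=> L_gt0 sep.
have shift_lt (j : {ffun I -> 'I_(2 * K)}) (l : 'I_K) k :
    (j k + L * l * e k < (2 + L) * K)%N.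
  have := ltn_ord (j k); have := ltn_ord l => lK jK.
  have : (L * l * e k <= L * K)%N.
    case: (e k); last by rewrite muln0.
    by rewrite muln1 leq_mul2l (ltnW lK) orbT.
  by move: jK; lia.
pose F (jl : {ffun I -> 'I_(2 * K)} * 'I_K) : {ffun I -> 'I_((2 + L) * K)} :=
  [ffun k => Ordinal (shift_lt jl.1 jl.2 k)].
have FE jl k : F jl k = (jl.1 k + L * jl.2 * e k)%N :> nat by rewrite ffunE.
have Flt (j j' : {ffun I -> 'I_(2 * K)}) (l l' : 'I_K) : j \in B -> j' \in B ->
    F (j, l) = F (j', l') -> ~ (l < l')%N.
  move=> jB j'B Fjl ll'; apply: (sep j j' (L * (l' - l))%N jB j'B).
    by rewrite leq_pmulr // subn_gt0.
  move=> k; have := congr1 (fun h : {ffun I -> _} => val (h k)) Fjl.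
  rewrite /= !FE /= => kE; apply/eqP; rewrite -(eqn_add2r (L * l * e k)) kE.
  by rewrite -addnA -mulnDl -mulnDr subnK // ltnW.
have Finj : {in finset.setX B [set: 'I_K]%SET &, injective F}.
  move=> [j l] [j' l'] /=; rewrite !finset.in_setX !finset.in_setT !andbT => jB j'B Fjl.
  have ll' : l = l'.
    apply: val_inj; case: (ltngtP l l') => // ll'.
    - by have := Flt j j' l l' jB j'B Fjl ll'.
    - by have := Flt j' j l' l j'B jB (esym Fjl) ll'.
  subst l'; congr pair; apply/ffunP => k; apply: val_inj; apply/eqP.
  have := congr1 (fun h : {ffun I -> _} => val (h k)) Fjl.
  by rewrite /= !FE /= => /eqP; rewrite eqn_add2r.
have -> : (#|B| * K = #|finset.setX B [set: 'I_K]%SET|)%N.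
  by rewrite cardsX cardsT card_ord.
rewrite -(card_in_imset Finj).
by rewrite (leq_trans (max_card _)) // card_ffun card_ord.
Qed.

(** * Cells of quadratic forms *)

Section Cells.
Variables (R : realType) (n : nat) (I : finType) (f g : I -> 'I_n.+1).
Hypothesis monomials : forall i j, exists k,
  (f k = i /\ g k = j) \/ (f k = j /\ g k = i).
Local Notation qf := (qform f g).
Local Notation isotropic := (isotropic f g).
Implicit Types (a b c d y z : I -> R) (u v x : 'rV[R]_n.+1).

Definition absum x := \sum_k `|x 0 (f k) * x 0 (g k)|.

(** The diagonal monomials select a sum of squares: this is the positive definite form along which
    cells are translated. *)
Definition sqsum x := qf (fun k => (f k == g k)%:R) x.

Lemma absum_ge0 x : 0 <= absum x. Proof. exact: sumr_ge0. Qed.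

Lemma qform_dist a b (r : R) x : (forall k, `|a k - b k| <= r) ->
  `|qf a x - qf b x| <= r * absum x.
Proof.
move=> ab; rewrite /qform -sumrB /absum mulr_sumr.
apply: (le_trans (ler_norm_sum _ _ _)); apply: ler_sum => k _.
by rewrite -mulrBl normrM ler_wpM2r.
Qed.

Lemma sqr_le_sqsum x i : x 0 i ^+ 2 <= sqsum x.
Proof.
have [k fgk] := monomials i i.
have [fk gk] : f k = i /\ g k = i by case: fgk => -[].
rewrite /sqsum /qform (bigD1 k) //= fk gk eqxx mul1r -expr2 lerDl.
apply: sumr_ge0 => k' _; case: eqP => [->|_]; last by rewrite mul0r.
by rewrite mul1r -expr2 sqr_ge0.
Qed.

Lemma sqsum_gt0 x : x != 0 -> 0 < sqsum x.
Proof.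
move=> x0; have [i xi] : exists i, x 0 i != 0.
  apply/existsP; apply: contra_neqT x0 => /existsPn xz.
  by apply/rowP => i; rewrite mxE; apply/eqP; have := xz i; rewrite negbK.
by apply: lt_le_trans (sqr_le_sqsum x i); rewrite exprn_even_gt0.
Qed.

Lemma absum_le x : absum x <= #|I|%:R * sqsum x.
Proof.
rewrite mulr_natl -sumr_const; apply: ler_sum => k _.
have := sqr_le_sqsum x (f k); have := sqr_le_sqsum x (g k).
set p := x 0 (f k); set q := x 0 (g k); set S := sqsum x => qS pS.
by rewrite ler_norml; apply/andP; split; nra.
Qed.

Definition in_cell (r : R) a y := forall k, a k <= y k < a k + r.

Lemma in_cell_dist r a y : in_cell r a y -> forall k, `|y k - a k| <= r.
Proof.
by move=> ay k; have /andP[ay1 ay2] := ay k; rewrite ler_norml; lra.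
Qed.

Lemma qform_in_cell r a y x : in_cell r a y ->
  qf a x - r * absum x <= qf y x <= qf a x + r * absum x.
Proof.
by move=> /in_cell_dist/(qform_dist x); rewrite ler_norml; lra.
Qed.

(** The margins [r * absum] bound how much a value can change within the cell with corner a, so all
    forms of the cell are positive at u and negative at v. *)
Definition mixed r a := exists u v,
  r * absum u < qf a u /\ qf a v < - (r * absum v).

Definition rootless r a :=
  forall y, in_cell r a y -> forall x, x != 0 -> qf y x != 0.

Lemma qform_diag_shift a b (r : R) x :
  (forall k, a k = b k + r * (f k == g k)%:R) ->
  qf a x = qf b x + r * sqsum x.
Proof.
move=> ab; rewrite /sqsum /qform mulr_sumr -big_split /=.
by apply: eq_bigr => k _; rewrite ab; ring.
Qed.

(** Two margins have to be beaten: the one in the lower bound on b and the variation over the cell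
    of a. Each is at most [r * #|I| * sqsum], whence l > 2 #|I|. *)
Lemma rootless_above (r : R) (l : nat) a b : 0 < r -> (2 * #|I| < l)%N ->
  (forall k, a k = b k + r * l%:R * (f k == g k)%:R) ->
  (forall x, - (r * absum x) <= qf b x) -> rootless r a.
Proof.
move=> r_gt0 l_gt ab b_ge y /qform_in_cell ay x x0; rewrite gt_eqF //.
have /andP[+ _] := ay x; apply: lt_le_trans; rewrite (qform_diag_shift x ab).
have := b_ge x; have := absum_le x; have := sqsum_gt0 x0.
set S := sqsum x; set T := absum x; set q := qf b x => S0 TS qT.
have : r * T <= r * (#|I|%:R * S) by rewrite ler_pM2l.
have : 0 < r * S * (l%:R - 2 * #|I|%:R).
  by rewrite !mulr_gt0 // subr_gt0 -natrM ltr_nat.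
lra.
Qed.

Lemma rootless_below (r : R) (l : nat) a b : 0 < r -> (2 * #|I| < l)%N ->
  (forall k, a k = b k + r * l%:R * (f k == g k)%:R) ->
  (forall x, qf a x <= r * absum x) -> rootless r b.
Proof.
move=> r_gt0 l_gt ab a_le y /qform_in_cell yb x x0; rewrite lt_eqF //.
have /andP[_] := yb x; move/le_lt_trans; apply.
have := a_le x; rewrite (qform_diag_shift x ab).
have := absum_le x; have := sqsum_gt0 x0.
set S := sqsum x; set T := absum x; set q := qf b x => S0 TS qT.
have : r * T <= r * (#|I|%:R * S) by rewrite ler_pM2l.
have : 0 < r * S * (l%:R - 2 * #|I|%:R).
  by rewrite !mulr_gt0 // subr_gt0 -natrM ltr_nat.
lra.
Qed.

Lemma continuous_absum : continuous absum.
Proof.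
have sum_continuous := @continuous_big R I +%R 0 xpredT (@add_continuous R).
apply: sum_continuous => k _ x.
apply: (@continuous_comp _ R R (fun y : 'rV[R]_n.+1 => y 0 (f k) * y 0 (g k))
  (fun r : R => `|r|)); first exact: continuous_monomial.
exact: norm_continuous.
Qed.

Lemma continuous_ray u v : continuous (fun t : R => u + t *: v).
Proof.
move=> t; apply: cvgD; first exact: cvg_cst.
by apply: cvgZr_tmp; exact: cvg_id.
Qed.

Lemma positive_on_segment (h : 'rV[R]_n.+1 -> R) u v : continuous h ->
  0 < h u -> exists2 eps : R, 0 < eps &
    forall t, `|t| <= eps -> 0 < h (u + t *: v).
Proof.
move=> hc hu; pose ht t := h (u + t *: v).
have htc : {for 0, continuous ht}.
  apply: (@continuous_comp R 'rV[R]_n.+1 R (fun t => u + t *: v) h).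
    exact: continuous_ray.
  exact: hc.
have : \forall t \near (0 : R), 0 < ht t.
  by apply: (@cvgr_gt R R (nbhs (0 : R)) _ ht (ht 0) htc);
    rewrite /ht scale0r addr0.
move=> /nbhs_ballP[e /= e0 he]; exists (e / 2); first by rewrite divr_gt0.
move=> t te; apply: he; rewrite /ball /= sub0r normrN.
by apply: le_lt_trans te _; lra.
Qed.

Lemma qform_root_on_segment z u v (eps : R) : 0 <= eps ->
  qf z (u + eps *: v) * qf z (u - eps *: v) <= 0 ->
  exists2 t, `|t| <= eps & qf z (u + t *: v) = 0.
Proof.
move=> eps0 zuv; pose h t := qf z (u + t *: v).
have [|||t te ht] := @IVT R h (- eps) eps 0.
- by lra.
- apply: continuous_subspaceT => t.
  apply: (@continuous_comp R 'rV[R]_n.+1 R (fun t => u + t *: v) (qf z)).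
    exact: continuous_ray.
  exact: continuous_qform.
- rewrite ge_min le_max /h scaleNr; move: zuv.
  set p := qf _ _; set q := qf _ _ => pq.
  by have [] := lerP p 0; have [] := lerP q 0 => //=; nra.
- by exists t => //; rewrite ler_norml; move: te; rewrite in_itv.
Qed.

Lemma qform_monomial i j : exists c, forall x, qf c x = x 0 i * x 0 j.
Proof.
have [k fgk] := monomials i j; exists (fun k' => (k' == k)%:R) => x.
rewrite /qform (bigD1 k) //= eqxx mul1r big1 ?addr0 => [|k' /negbTE->].
  by case: fgk => -[-> ->] //; rewrite mulrC.
by rewrite mul0r.
Qed.

(** Otherwise v is a multiple of u, and the form cannot take opposite signs at the two. *)
Lemma minor_neq0 a u v : 0 < qf a u -> qf a v < 0 ->
  exists i j, u 0 i * v 0 j - u 0 j * v 0 i != 0.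
Proof.
move=> u_gt0 v_lt0; apply: contrapT => /forallNP minor0.
have minor_eq i j : u 0 i * v 0 j = u 0 j * v 0 i.
  apply/eqP; rewrite -subr_eq0; apply: contrapT => /negP uv.
  by apply: (minor0 i); exists j.
have [i ui] : exists i, u 0 i != 0.
  apply: contrapT => /forallNP ui; have u0 : u = 0.
    by apply/rowP => i; rewrite mxE; apply/eqP; apply: contrapT => /negP /ui.
  by move: u_gt0; rewrite u0 qform0 ltxx.
have vE : v = (v 0 i / u 0 i) *: u.
  apply/rowP => j; rewrite mxE; apply: (mulfI ui); rewrite minor_eq.
  by rewrite mulrA mulrCA divff // mulr1 mulrC.
move: v_lt0; rewrite vE qformZ ltNge mulr_ge0 ?sqr_ge0 //; exact: ltW.
Qed.

(* Product of two linear forms vanishing at u and at v respectively. *)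
Lemma hyperbolic_form u v i j :
  exists c, forall t : R,
    qf c (u + t *: v) = t * (u 0 i * v 0 j - u 0 j * v 0 i) ^+ 2 /\
    qf c (v + t *: u) = t * (u 0 i * v 0 j - u 0 j * v 0 i) ^+ 2.
Proof.
have [cii ciiE] := qform_monomial i i.
have [cij cijE] := qform_monomial i j.
have [cjj cjjE] := qform_monomial j j.
exists (fun k => - (u 0 j * v 0 j) * cii k
    + (u 0 j * v 0 i + u 0 i * v 0 j) * cij k - (u 0 i * v 0 i) * cjj k) => t.
have cE x : qf (fun k => - (u 0 j * v 0 j) * cii k
    + (u 0 j * v 0 i + u 0 i * v 0 j) * cij k - (u 0 i * v 0 i) * cjj k) x =
    - (u 0 j * v 0 j) * (x 0 i * x 0 i)
    + (u 0 j * v 0 i + u 0 i * v 0 j) * (x 0 i * x 0 j)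
    - (u 0 i * v 0 i) * (x 0 j * x 0 j).
  rewrite -ciiE -cijE -cjjE /qform !mulr_sumr -sumrN -!big_split /=.
  by apply: eq_bigr => k _; ring.
by rewrite !cE !mxE; split; ring.
Qed.

Lemma qform_neq0 c x : qf c x != 0 -> x != 0.
Proof. by apply: contra_neq => ->; rewrite qform0. Qed.

(** The centre z0 is a product of linear forms that changes sign at u in direction v and at v in
    direction u. A form z near z0 still changes sign along short segments there and has roots on
    them, where y keeps the signs it has at u and v. *)
Lemma mixed_hub (r : R) a : 0 <= r -> mixed r a ->
  exists z0 : I -> R, exists2 eta : R, 0 < eta &
  forall y z, in_cell r a y -> (forall k, `|z k - z0 k| < eta) ->
  exists u v, [/\ isotropic z u, isotropic z v, 0 < qf y u & qf y v < 0].
Proof.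
move=> r_ge0 [u [v [u_gt v_lt]]].
have r_absum_ge0 x : 0 <= r * absum x by rewrite mulr_ge0 ?absum_ge0.
have [i [j]] : exists i j, u 0 i * v 0 j - u 0 j * v 0 i != 0.
  apply: (@minor_neq0 a); first exact: le_lt_trans u_gt.
  by apply: lt_le_trans v_lt _; rewrite oppr_le0.
have [z0 z0E] := hyperbolic_form u v i j; move: z0E.
set D2 := (_ - _) ^+ 2 => z0E minor0.
have D2_gt0 : 0 < D2 by rewrite exprn_even_gt0.
clearbody D2; clear minor0.
have r_absum_c : continuous (fun x => r * absum x).
  move=> x; apply: (@continuousM R _ (fun _ => r) absum x).
    exact: cst_continuous.
  exact: continuous_absum.
have [e1 e1_gt0 u_seg] : exists2 e : R, 0 < e & forall t, `|t| <= e ->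
    0 < qf a (u + t *: v) - r * absum (u + t *: v).
  apply: (@positive_on_segment (fun x => qf a x - r * absum x)).
    move=> x; apply: (@continuousB R R _ (qf a) (fun x => r * absum x) x).
      exact: continuous_qform.
    exact: r_absum_c.
  by rewrite subr_gt0.
have [e2 e2_gt0 v_seg] : exists2 e : R, 0 < e & forall t, `|t| <= e ->
    0 < - qf a (v + t *: u) - r * absum (v + t *: u).
  apply: (@positive_on_segment (fun x => - qf a x - r * absum x)).
    move=> x.
    apply: (@continuousB R R _ (fun x => - qf a x) (fun x => r * absum x) x).
      by apply: (@continuousN R R _ (qf a) x); exact: continuous_qform.
    exact: r_absum_c.
  by lra.
pose eps := Num.min e1 e2.
have eps_gt0 : 0 < eps by rewrite lt_min e1_gt0.
(* T bounds [absum] at the four endpoints. With eta = eps D2 / (1 + T), z differs from z0 by less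
   than eps D2 at each of them, and eps D2 is the absolute value of z0 there. *)
pose T := absum (u + eps *: v) + absum (u - eps *: v)
        + (absum (v + eps *: u) + absum (v - eps *: u)).
have T1_gt0 : 0 < 1 + T by rewrite ltr_pwDl // !addr_ge0 ?absum_ge0.
exists z0, (eps * D2 / (1 + T)); first by rewrite divr_gt0 ?mulr_gt0.
move=> y z ay zz0.
have z_dist x : absum x <= T -> `|qf z x - qf z0 x| < eps * D2.
  move=> xT; have /(qform_dist x)/le_lt_trans-> // :
    forall k, `|z k - z0 k| <= eps * D2 / (1 + T) by move=> k; exact: ltW.
  rewrite mulrAC ltr_pdivrMr // ltr_pM2l ?mulr_gt0 //.
  by apply: le_lt_trans xT _; rewrite ltrDr.
have root w w' : (forall t, qf z0 (w + t *: w') = t * D2) ->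
    absum (w + eps *: w') <= T -> absum (w - eps *: w') <= T ->
    exists2 t, `|t| <= eps & qf z (w + t *: w') = 0.
  move=> z0w wT w'T; apply: qform_root_on_segment; first exact: ltW.
  have := z_dist _ wT; have := z_dist _ w'T.
  rewrite -scaleNr !z0w !ltr_norml => /andP[_ zm] /andP[zp _].
  by apply: mulr_ge0_le0; lra.
have := absum_ge0 (u + eps *: v); have := absum_ge0 (u - eps *: v).
have := absum_ge0 (v + eps *: u); have := absum_ge0 (v - eps *: u).
move=> T4 T3 T2 T1.
have [||t teps zt] := root u v (fun t => (z0E t).1); rewrite /T; [lra|lra|].
have [||t' t'eps zt'] := root v u (fun t => (z0E t).2); rewrite /T; [lra|lra|].
have ut : 0 < qf y (u + t *: v).
  have := u_seg t; rewrite (le_trans teps) ?ge_min ?lexx // => /(_ isT).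
  by have /andP[+ _] := qform_in_cell (u + t *: v) ay; lra.
have vt : qf y (v + t' *: u) < 0.
  have := v_seg t'; rewrite (le_trans t'eps) ?ge_min ?lexx ?orbT // => /(_ isT).
  by have /andP[_] := qform_in_cell (v + t' *: u) ay; lra.
exists (u + t *: v), (v + t' *: u); split=> //; split=> //.
- by apply: (@qform_neq0 y); rewrite gt_eqF.
- by apply: (@qform_neq0 y); rewrite lt_eqF.
Qed.

End Cells.

(** * Gaussian estimates *)

Section Gaussian.
Variables (R : realType) (sigma : R).
Hypothesis sigma_neq0 : sigma != 0.
Local Notation gamma := (normal_prob (0 : R) sigma).

Lemma normal_prob_itv_le (a b : R) : a <= b ->
  (gamma `[a, b[ <= (normal_peak sigma * (b - a))%:E)%E.
Proof.
move=> ab; rewrite /normal_prob.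
apply: (@le_trans _ _ (\int[lebesgue_measure]_(x in `[a, b[) (normal_peak sigma)%:E)%E).
  apply: ge0_le_integral => //=.
  - by move=> x _; rewrite lee_fin normal_pdf_ge0.
  - by apply/measurable_EFinP/measurable_funTS; exact: measurable_normal_pdf.
  - by move=> x _; rewrite lee_fin normal_pdf_ub.
rewrite integral_cst //= lebesgue_measure_itv /= lte_fin.
case: ltP => [_|ba]; first by rewrite -EFinB -EFinM.
by rewrite mule0 lee_fin mulr_ge0 ?normal_peak_ge0 ?subr_ge0.
Qed.

Lemma normal_prob_itv_gt0 (c eta : R) : 0 < eta ->
  (0 < gamma [set x : R | (`|x - c| < eta)%R])%E.
Proof.
move=> eta0.
set D := [set x | _].
have DE : D = `]c - eta, c + eta[%classic.
  by apply/seteqP; split=> x /=; rewrite /D /= in_itv /= ltr_norml; lra.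
have mD : measurable D by rewrite DE.
(* The density at |c| + eta, which bounds it from below on the interval. *)
pose m := normal_peak sigma * expR (- (`|c| + eta) ^+ 2 / (sigma ^+ 2 *+ 2)).
have m0 : 0 < m by rewrite mulr_gt0 ?normal_peak_gt0 ?expR_gt0.
rewrite /normal_prob.
apply: (@lt_le_trans _ _ (\int[lebesgue_measure]_(x in D) m%:E)%E).
  rewrite integral_cst //= DE lebesgue_measure_itv /= lte_fin ifT; last by lra.
  by rewrite -EFinB -EFinM lte_fin mulr_gt0 //; lra.
apply: ge0_le_integral => //=.
- by move=> x _; rewrite lee_fin ltW.
- by apply/measurable_EFinP/measurable_funTS; exact: measurable_normal_pdf.
- move=> x Dx; rewrite lee_fin normal_pdfE //.
  rewrite ler_pM2l ?normal_peak_gt0 // ler_expR ler_pM2r; last first.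
    by rewrite invr_gt0 pmulrn_lgt0 // exprn_even_gt0.
  rewrite lerN2 subr0 -(real_normK (num_real x)) lerXn2r ?nnegrE ?addr_ge0 //.
    exact: ltW.
  by rewrite -[x](subrK c) addrC (le_trans (ler_normD _ _)) // lerD2l ltW.
Qed.

(** The complements decrease to the empty set, so continuity from above applies. *)
Lemma normal_prob_tail (eps : R) : 0 < eps ->
  \forall N \near \oo, (gamma (~` `[(- N%:R)%R, N%:R%R[) <= eps%:E)%E.
Proof.
move=> eps0; pose F (N : nat) : set R := ~` `[- N%:R, N%:R[.
have mF N : measurable (F N) by apply: measurableC.
have cap0 : \bigcap_N F N = set0.
  apply/seteqP; split=> // x Fx.
  have := Fx (Num.truncn `|x|).+1 Logic.I; apply; rewrite /= in_itv /=.
  by have := truncnS_gt `|x|; rewrite ltr_norml => /andP[/ltW-> ->].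
have : gamma (F N) @[N --> \oo] --> gamma (\bigcap_N F N).
  apply: nonincreasing_cvg_mu => //.
  - apply: (@le_lt_trans _ _ 1%E); last exact: ltry.
    exact: (@probability_le1 _ _ R (normal_prob (0 : R) sigma) _ (mF 0%N)).
  - by rewrite cap0.
  - apply/nonincreasing_seqP => N; apply/subsetPset => x /=.
    rewrite /F /= !in_itv /= => h1 h2; apply: h1; move: h2.
    by rewrite -natr1 => /andP[x1 x2]; apply/andP; split; lra.
rewrite cap0 measure0 => /fine_cvgP[Ffin Fcvg].
have Fle : \forall N \near \oo, fine (gamma (F N)) <= eps.
  by apply: (@cvgr_le _ _ _ _ _ _ Fcvg).
near=> N.
rewrite -[X in (X <= _)%E]fineK ?lee_fin; [by near: N|by near: N].
Unshelve. all: by end_near.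
Qed.

End Gaussian.

(** * Coefficients of quadrics *)

Section Exponents.
Variables (R : realType) (n : nat).

(** Instantiates the abstract index type [I] of the sections on forms; [fst_index] and [snd_index]
    instantiate f and g. *)
Definition quad_exponent :=
  {a : mpoly.bmultinom n.+1 3 | mpoly.mdeg (mpoly.bmnm a) == 2%N}.

Definition exponent (k : quad_exponent) : mpoly.multinom n.+1 :=
  mpoly.bmnm (val k).

Lemma exponent_inj : injective exponent.
Proof. by move=> k k' kk'; do 2! apply: val_inj. Qed.

Lemma mdeg_exponent k : mpoly.mdeg (exponent k) = 2%N.
Proof. by apply/eqP; exact: (valP k). Qed.

Lemma mdeg2_split (a : mpoly.multinom n.+1) : mpoly.mdeg a = 2%N ->
  exists i j, a = mpoly.mnm_add (mpoly.mnm1 i) (mpoly.mnm1 j).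
Proof.
move=> a2; have [i ai] : exists i, mpoly.fun_of_multinom a i != 0%N.
  apply: contrapT => /forallNP a0; move: a2; rewrite mpoly.mdegE big1 // => i _.
  by apply/eqP; apply: contrapT => /negP /a0.
have ia : mpoly.lem (mpoly.mnm1 i) a by rewrite mpoly.lep1mP.
have aE := mpoly.submK ia.
have /eqP/mpoly.mdeg1P[j /eqP aj] :
    mpoly.mdeg (mpoly.mnm_sub a (mpoly.mnm1 i)) = 1%N.
  by apply/eqP; move: a2; rewrite -[in LHS]aE mpoly.mdegD mpoly.mdeg1 addn1 => -[->].
by exists j, i; rewrite -aj aE.
Qed.

Lemma exponent_pair (k : quad_exponent) : exists ij : 'I_n.+1 * 'I_n.+1,
  exponent k = mpoly.mnm_add (mpoly.mnm1 ij.1) (mpoly.mnm1 ij.2).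
Proof.
by have [i [j ->]] := mdeg2_split (mdeg_exponent k); exists (i, j).
Qed.

(** The order of the two indices is an arbitrary choice; hence the two cases in
    [quad_exponent_monomials]. *)
Definition fst_index (k : quad_exponent) := (sval (cid (exponent_pair k))).1.
Definition snd_index (k : quad_exponent) := (sval (cid (exponent_pair k))).2.

Lemma exponentE k : exponent k =
  mpoly.mnm_add (mpoly.mnm1 (fst_index k)) (mpoly.mnm1 (snd_index k)).
Proof. exact: svalP (cid (exponent_pair k)). Qed.

Lemma mnm1_add_inj (i j i' j' : 'I_n.+1) :
  mpoly.mnm_add (mpoly.mnm1 i) (mpoly.mnm1 j) =
  mpoly.mnm_add (mpoly.mnm1 i') (mpoly.mnm1 j') ->
  (i = i' /\ j = j') \/ (i = j' /\ j = i').
Proof.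
move=> ij; have E l : ((i == l) + (j == l) = (i' == l) + (j' == l))%N.
  have := congr1 (fun a => mpoly.fun_of_multinom a l) ij.
  by rewrite !mpoly.mnmDE !mpoly.mnm1E.
move: (E i) (E j) (E i'); rewrite !eqxx; case: (eqVneq i i') => [<-|ii'].
  move=> _ + _; case: (eqVneq j' j) => [->|_]; first by left.
  by case: (i == j).
case: (eqVneq j i') => [<-|_]; last by [].
by case: (eqVneq i j') => [<-|_]; [right | case: (j == i)].
Qed.

Lemma quad_exponent_monomials (i j : 'I_n.+1) : exists k,
  (fst_index k = i /\ snd_index k = j) \/ (fst_index k = j /\ snd_index k = i).
Proof.
have ij2 : mpoly.mdeg (mpoly.mnm_add (mpoly.mnm1 i) (mpoly.mnm1 j)) = 2%N.
  by rewrite mpoly.mdegD !mpoly.mdeg1.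
have ij3 : (mpoly.mdeg (mpoly.mnm_add (mpoly.mnm1 i) (mpoly.mnm1 j)) < 3)%N.
  by rewrite ij2.
have kP : mpoly.mdeg (mpoly.bmnm (mpoly.BMultinom ij3)) == 2%N by exact/eqP.
exists (exist _ (mpoly.BMultinom ij3) kP).
by apply: mnm1_add_inj; rewrite -exponentE.
Qed.

Lemma quadric_evaluates_to (c : mpoly.multinom n.+1 -> R) :
  evaluates_to (@fst_index) (@snd_index)
   (\sum_(a : mpoly.bmultinom n.+1 3 | mpoly.mdeg (mpoly.bmnm a) == 2%N)
     c (mpoly.bmnm a) *: mpoly.mpolyX R (mpoly.bmnm a))
   (fun k => c (exponent k)).
Proof.
move=> x; rewrite (big_morph _ (mpoly.mevalD _) (mpoly.meval0 _)).
pose A := [pred a : mpoly.bmultinom n.+1 3 | mpoly.mdeg (mpoly.bmnm a) == 2%N].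
transitivity (\sum_(a in A)
  mpoly.meval (fun i => x 0 i)
    (c (mpoly.bmnm a) *: mpoly.mpolyX R (mpoly.bmnm a))).
  exact: eq_bigl.
rewrite big_sub; apply: eq_bigr => k _.
rewrite mpoly.mevalZ -/(exponent k) [in mpoly.mpolyX _ _]exponentE.
by rewrite mpoly.mpolyXD mpoly.mevalM !mpoly.mevalXU.
Qed.

Lemma mcoeff_quadric (c : mpoly.multinom n.+1 -> R) k :
  mpoly.mcoeff (exponent k)
   (\sum_(a : mpoly.bmultinom n.+1 3 | mpoly.mdeg (mpoly.bmnm a) == 2%N)
     c (mpoly.bmnm a) *: mpoly.mpolyX R (mpoly.bmnm a)) = c (exponent k).
Proof.
rewrite (big_morph _ (mpoly.mcoeffD _) (mpoly.mcoeff0 _ _)).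
rewrite (bigD1 (val k)) /=; last exact: (valP k).
rewrite mpoly.mcoeffZ mpoly.mcoeffX eqxx mulr1 big1 ?addr0 // => a /andP[_ ak].
rewrite mpoly.mcoeffZ mpoly.mcoeffX; case: eqP => [aE|_]; last by rewrite mulr0.
by move: ak; rewrite (val_inj aE : a = val k) eqxx.
Qed.

End Exponents.

(** * Integral and product inequalities *)

(** The integrand [b], later the number of components, is an arbitrary nonnegative function: its
    integral is the supremum over simple functions below it, which is monotone in [b]. *)
Lemma le_integral_sum_indic d (T : measurableType d) (R : realType)
    (P : probability T R) (b : T -> \bar R) (E : finType) (a : R) (w : E -> R)
    (F : E -> set T) :
  (forall t, 0 <= b t)%E -> 0 <= a -> (forall e, 0 <= w e) ->
  (forall e, measurable (F e)) ->
  (forall t, b t <= (a + \sum_e w e * \1_(F e) t)%:E)%E ->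
  (\int[P]_t b t <= a%:E + \sum_e (w e)%:E * P (F e))%E.
Proof.
move=> b_ge0 a_ge0 w_ge0 mF b_le.
have term_ge0 e t : (0 <= (w e * \1_(F e) t)%:E)%E by rewrite lee_fin mulr_ge0.
have mterm e : measurable_fun setT (fun t => (w e * \1_(F e) t)%:E).
  by apply/measurable_EFinP; apply: measurable_funM.
apply: (@le_trans _ _ (\int[P]_t (a%:E + \sum_e (w e * \1_(F e) t)%:E))%E).
  rewrite !ge0_integralTE //; last first.
    by move=> t; rewrite adde_ge0 ?lee_fin // sume_ge0.
  apply: ereal_sup_le => _ [h hb <-]; exists h => // t.
  by rewrite (le_trans (hb t)) // (le_trans (b_le t)) // EFinD -sumEFin.
rewrite ge0_integralD //; first last.
- by apply: emeasurable_sum.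
- by move=> t _; rewrite sume_ge0.
have -> : (\int[P]_t a%:E = a%:E)%E.
  rewrite integral_cst // -[RHS]mule1; congr (_ * _)%E.
  exact: probability_setT.
rewrite leeD2l //.
rewrite ge0_integral_sum //; apply: lee_sum => e _.
under eq_integral do rewrite EFinM.
rewrite ge0_integralZl_EFin //; first by rewrite integral_indic // setIT.
by apply/measurable_EFinP.
Qed.

Lemma lee_prod (R : realDomainType) (I : Type) (r : seq I) (F G : I -> \bar R) :
  (forall i, 0 <= F i <= G i)%E ->
  (\prod_(i <- r) F i <= \prod_(i <- r) G i)%E.
Proof.
move=> FG; suff /andP[] : (0 <= \prod_(i <- r) F i <= \prod_(i <- r) G i)%E by [].
apply: (big_ind2 (fun x y => 0 <= x <= y)%E) => //.
  by rewrite lexx lee_fin ler01.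
move=> x1 y1 x2 y2 /andP[x1_ge0 xy1] /andP[x2_ge0 xy2].
by rewrite mule_ge0 // lee_pmul.
Qed.

(** * Law of the coefficients of Kostlan quadrics *)

Section KostlanCoefficients.
Variables (R : realType) (n : nat).

Definition coef_sd (k : quad_exponent n) : R :=
  Num.sqrt (2`!%:R / (\prod_i (exponent k i)`!)%N%:R).

Lemma coef_sd_neq0 k : coef_sd k != 0.
Proof.
rewrite gt_eqF // sqrtr_gt0 divr_gt0 // ltr0n ?fact_gt0 //.
by rewrite prodn_gt0 // => i; exact: fact_gt0.
Qed.

Definition coef_prob k : set R -> \bar R := normal_prob 0 (coef_sd k).

Variables (d : measure_display) (T : measurableType d) (P : probability T R).

Definition coef (p : T -> mpoly.mpoly n.+1 R) (k : quad_exponent n) (t : T) : R :=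
  mpoly.mcoeff (exponent k) (p t).

Lemma kostlan_evaluates_to p t : kostlan P 2 p ->
  evaluates_to (@fst_index n) (@snd_index n) (p t) (coef p ^~ t).
Proof.
move=> [xi [_ _ pE]]; rewrite pE => x.
rewrite (quadric_evaluates_to (fun a => xi a t)).
by apply: eq_bigr => k _; rewrite /coef pE (mcoeff_quadric (fun a => xi a t)).
Qed.

Lemma measurable_coef p k : kostlan P 2 p -> measurable_fun setT (coef p k).
Proof.
move=> [xi [_ _ pE]]; have -> : coef p k = xi (exponent k).
  by apply/funext => t; rewrite /coef pE (mcoeff_quadric (fun a => xi a t)).
exact: measurable_funP.
Qed.

Lemma coef_distribution p k A : kostlan P 2 p -> measurable A ->
  P (coef p k @^-1` A) = coef_prob k A.
Proof.
move=> [xi [_ xiN pE]] mA; have -> : coef p k = xi (exponent k).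
  by apply/funext => t; rewrite /coef pE (mcoeff_quadric (fun a => xi a t)).
exact: (xiN _ (mdeg_exponent k) A mA).
Qed.

Definition coef_box (p : T -> mpoly.mpoly n.+1 R)
    (A : quad_exponent n -> set R) : set T :=
  \bigcap_(k in [set: quad_exponent n]) coef p k @^-1` A k.

Lemma measurable_coef_box p A : kostlan P 2 p -> (forall k, measurable (A k)) ->
  measurable (coef_box p A).
Proof.
move=> pK mA; apply: fin_bigcap_measurable => [|k _]; first exact: finite_finset.
by rewrite -[X in measurable X]setTI; exact: measurable_coef.
Qed.

Lemma coef_box_prob p A : kostlan P 2 p -> (forall k, measurable (A k)) ->
  P (coef_box p A) = (\prod_k coef_prob k (A k))%E.
Proof.
move=> pK mA; have cP := coef_distribution _ pK.
move: (pK) => [xi [xi_indep _ pE]].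
have coefE k : coef p k = xi (exponent k).
  by apply/funext => t; rewrite /coef pE (mcoeff_quadric (fun a => xi a t)).
pose J := [fset exponent k | k in @predT (quad_exponent n)]%fset.
(* Independence speaks of events indexed by all exponents; those of degree other than 2 receive the
   whole space. *)
pose E a := if [pick k | exponent k == a] is Some k
  then coef p k @^-1` A k else setT.
have EE k : E (exponent k) = coef p k @^-1` A k.
  rewrite /E; case: pickP => [k' /eqP/exponent_inj->//|/(_ k)].
  by rewrite eqxx.
have JP a : reflect (exists k, a = exponent k) (a \in J).
  by apply: (iffP (imfsetP _ _ _ _)) => [[k _ ->]|[k ->]]; exists k.
have := xi_indep J E.
have -> : \bigcap_(i in [set` J]) E i = coef_box p A.
  apply/seteqP; split=> t tE.
  - by move=> k _; rewrite -EE; apply: tE; apply/JP; exists k.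
  - by move=> a /JP[k ->]; rewrite EE; exact: tE.
move=> ->.
- rewrite big_imfset /=; last by move=> k k' _ _; exact: exponent_inj.
  rewrite big_enum /=; apply: eq_bigr => k _.
  by rewrite -[E _]/(E (exponent k)) EE cP.
- by move=> a /JP[k ->]; exact: mdeg_exponent.
- move=> a /JP[k ->]; rewrite EE coefE; exists (A k) => //.
  by rewrite setTI.
Qed.

End KostlanCoefficients.

Lemma independent_coef_boxes_avoid (R : realType) (n : nat) d (T : measurableType d)
    (P : probability T R) (s : nat) (p : 'I_s -> T -> mpoly.mpoly n.+1 R)
    (A : quad_exponent n -> set R) :
  (forall i, kostlan P 2 (p i)) -> independent_polys P p ->
  (forall k, measurable (A k)) ->
  P (\bigcap_(i in [set: 'I_s]) ~` coef_box (p i) A) =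
  ((1 - fine (\prod_k coef_prob k (A k))%E) ^+ s)%:E.
Proof.
move=> pK p_indep mA.
pose J := [fset i | i in @predT 'I_s]%fset.
have JT i : i \in J by apply/imfsetP; exists i.
have := p_indep J (fun i => ~` coef_box (p i) A).
have -> : [set` J] = [set: 'I_s] by apply/seteqP; split=> i _ //=; exact: JT.
move=> ->//.
  rewrite big_imfset //= big_enum /=.
  rewrite (eq_bigr (fun=> (1 - fine (\prod_k coef_prob k (A k))%E)%:E)).
    by rewrite prodEFin prodr_const card_ord.
  move=> i _; have mbox := measurable_coef_box (pK i) mA.
  rewrite probability_setC // EFinB -(coef_box_prob (pK i)) // fineK //.
  exact: fin_num_measure.
move=> i _.
(* The independence of the polynomials requires the event to lie in the sigma-algebra generated by
   the coefficients of [p i], which is finer information than measurability in T. *)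
pose G := \bigcup_a sigma_of (fun t => mpoly.mcoeff a (p i t)).
have mbox : measurable (coef_box (p i) A : set (g_sigma_algebraType G)).
  apply: fin_bigcap_measurable => [|k _]; first exact: finite_finset.
  apply: sub_sigma_algebra.
  by exists (exponent k) => //; exists (A k) => //; rewrite setTI.
exact: (measurableC mbox).
Qed.

(** * The grid *)

Section Grid.
Variables (R : realType) (n : nat).
Local Notation I := (quad_exponent n).
Local Notation fi := (@fst_index n).
Local Notation gi := (@snd_index n).
Variables (rad : R) (K : nat).
Hypotheses (rad_gt0 : 0 < rad) (K_gt0 : (0 < K)%N).
Local Notation cell := {ffun I -> 'I_(2 * K)}.
Local Notation step := (rad / K%:R).

(** The 2K steps of length rad / K cover [- rad, rad) in each coordinate. *)
Definition corner (j : cell) (k : I) : R := - rad + step * (j k)%:R.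

Definition cell_itv (j : cell) (k : I) : set R :=
  `[corner j k, corner j k + step[%classic.

Definition bad_cells : {set cell} := [set j : cell |
  `[< ~ mixed fi gi step (corner j) /\ ~ rootless fi gi step (corner j) >]]%SET.

Let step_gt0 : 0 < step. Proof. by rewrite divr_gt0 // ltr0n. Qed.

(** A bad cell is not rootless, and since it is not mixed its corner form is nonnegative up to the
    margin ([above]) or nonpositive up to the margin ([below]). By the rootless lemmas two cells of
    one kind never differ by more than 2 #|I| diagonal steps, so the antichain count applies to each
    kind. *)
Lemma card_bad_cells :
  (#|bad_cells| * K <= 2 * ((2 + (2 * #|{: I}|).+1) * K) ^ #|{: I}|)%N.
Proof.
pose above : {set cell} := [set j : cell | `[< ~ rootless fi gi step (corner j) /\
  forall x, - (step * absum fi gi x) <= qform fi gi (corner j) x >]]%SET.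
pose below : {set cell} := [set j : cell | `[< ~ rootless fi gi step (corner j) /\
  forall x, qform fi gi (corner j) x <= step * absum fi gi x >]]%SET.
have corner_shift (j j' : cell) l :
    (forall k, j k = (j' k + l * (fi k == gi k))%N :> nat) ->
    forall k, corner j k = corner j' k + step * l%:R * (fi k == gi k)%:R.
  by move=> jj' k; rewrite /corner jj' natrD natrM; ring.
have card_above := @card_antichain_cells I (fun k => fi k == gi k) K
  (2 * #|{: I}|).+1 above isT.
have card_below := @card_antichain_cells I (fun k => fi k == gi k) K
  (2 * #|{: I}|).+1 below isT.
have sub : bad_cells \subset above :|: below.
  apply/fintype.subsetP => j; rewrite inE => /asboolP[nmixed nroot]; rewrite !inE.
  apply: contraT; rewrite negb_or => /andP[/asboolPn nA /asboolPn nB].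
  exfalso; apply: nmixed.
  have /existsNP[u /negP uP] :
      ~ forall x, qform fi gi (corner j) x <= step * absum fi gi x.
    by move=> h; apply: nB.
  have /existsNP[v /negP vP] :
      ~ forall x, - (step * absum fi gi x) <= qform fi gi (corner j) x.
    by move=> h; apply: nA.
  by exists u, v; rewrite !ltNge.
apply: (@leq_trans ((#|above| + #|below|) * K)).
  by rewrite leq_mul2r (leq_trans (subset_leq_card sub)) ?orbT // leq_card_setU.
rewrite mulnDl [leqRHS]mul2n -[leqRHS]addnn; apply: leq_add.
- apply: card_above => j j' l; rewrite !inE => -[jroot _] [_ j'P].
  move=> lL /corner_shift jj'; apply: jroot.
  exact: (rootless_above (@quad_exponent_monomials n) step_gt0 lL jj').
- apply: card_below => j j' l; rewrite !inE => -[_ jP] [j'root _].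
  move=> lL /corner_shift jj'; apply: j'root.
  exact: (rootless_below (@quad_exponent_monomials n) step_gt0 lL jj').
Qed.

Lemma grid_cover (y : I -> R) : (forall k, - rad <= y k < rad) ->
  exists j : cell, in_cell step (corner j) y.
Proof.
move=> y_rad; pose m k := Num.truncn ((y k + rad) / step).
have m_ge0 k : 0 <= (y k + rad) / step.
  by rewrite divr_ge0 ?(ltW step_gt0) //; have := y_rad k; lra.
have mK k : (m k < 2 * K)%N.
  rewrite -(ltr_nat R) (le_lt_trans (_ : _ <= (y k + rad) / step)) //.
    by rewrite truncn_le.
  rewrite ltr_pdivrMr //.
  have -> : (2 * K)%:R * step = rad + rad.
    by rewrite natrM; field; rewrite pnatr_eq0 -lt0n.
  by have := y_rad k; lra.
exists [ffun k => Ordinal (mK k)] => k; rewrite /corner ffunE /=.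
have /andP[m1 m2] : (m k)%:R <= (y k + rad) / step < (m k).+1%:R.
  exact: truncn_itv.
move: m1 m2; rewrite ler_pdivlMr // ltr_pdivrMr // -natr1 mulrDl mul1r.
by rewrite [(m k)%:R * _]mulrC; lra.
Qed.

End Grid.

(** * Bounding the number of components by exceptional events *)

Section PointwiseBound.
Variables (R : realType) (n : nat) (rad : R) (K : nat).
Local Notation I := (quad_exponent n).
Local Notation fi := (@fst_index n).
Local Notation gi := (@snd_index n).
Local Notation cell := {ffun I -> 'I_(2 * K)}.
Local Notation step := (rad / K%:R).
Hypotheses (n_ge2 : (2 <= n)%N) (rad_gt0 : 0 < rad) (K_gt0 : (0 < K)%N).
Variables (z0 : cell -> I -> R) (eta : cell -> R).
Hypothesis hub : forall j : cell, mixed fi gi step (corner rad j) ->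
  forall y z, in_cell step (corner rad j) y ->
    (forall k, `|z k - z0 j k| < eta j) ->
  exists u v, [/\ isotropic fi gi z u, isotropic fi gi z v,
    0 < qform fi gi y u & qform fi gi y v < 0].

Definition hub_box (j : cell) (k : I) : set R :=
  [set x | `|x - z0 j k| < eta j].

Variables (d : measure_display) (T : measurableType d) (P : probability T R).
Variables (s : nat) (p : 'I_s -> T -> mpoly.mpoly n.+1 R).
Hypothesis pK : forall i, kostlan P 2 (p i).

(* A coefficient leaves the grid, the polynomial lies in
   a bad cell, or no polynomial lies in the hub box of a cell, respectively. *)
Definition exception : finType := ('I_s * (I + cell) + cell)%type.

Definition exception_event (e : exception) : set T :=
  match e with
  | inl (i, inl k) => coef (p i) k @^-1` (~` `[- rad, rad[)
  | inl (i, inr j) => coef_box (p i) (cell_itv rad j)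
  | inr j => \bigcap_(i in [set: 'I_s]) ~` coef_box (p i) (hub_box j)
  end.

(** The number of components charged to an exception: one for a single exceptional quadric, none if
    its cell is good, and the trivial bound s if a hub is missing. *)
Definition exception_weight (e : exception) : R :=
  match e with
  | inl (_, inl _) => 1
  | inl (_, inr j) => (j \in bad_cells n rad K)%:R
  | inr _ => s%:R
  end.

(** If every hub box is hit, one hub per cell together with the exceptional quadrics forms a
    dominating set. *)
Lemma b0_le_exceptions t :
  (b0 R (\bigcup_(i in [set: 'I_s]) zero_locus (p i t)) <=
   (#|{: cell}|%:R +
    \sum_e exception_weight e * \1_(exception_event e) t)%:E)%E.
Proof.
pose y i k := coef (p i) k t.
have yE i : evaluates_to fi gi (p i t) (y i).
  exact: (kostlan_evaluates_to t (pK i)).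
pose a e := exception_weight e * \1_(exception_event e) t.
have a_ge0 e : 0 <= a e.
  by rewrite mulr_ge0 //; case: e => [[i [k|j]]|j] /=.
have le_sum (h : exception) : a h <= \sum_e a e.
  by rewrite (bigD1 h) //= lerDl sumr_ge0.
have conn i : connected (zero_locus (p i t)).
  exact: connected_zero_locus (yE i) n_ge2.
(* If a hub box is missed, all s indices are taken, which the weight s of this exception pays
   for. *)
have [[j jF]|hubs] := pselect (exists j, exception_event (inr j) t).
  apply: (le_trans (b0_dominating_set R conn (D := [set: 'I_s]%SET) _)).
    by move=> i x pix; exists i; [rewrite inE|exists x].
  rewrite lee_fin cardsT card_ord (le_trans _ (lerD (ler0n _ _) (le_sum (inr j)))) //.
  by rewrite add0r /a indicE mem_set // mulr1.
have /choice[h hP] : forall j, exists i, coef_box (p i) (hub_box j) t.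
  move=> j; apply: contrapT => /forallNP nj; apply: hubs; exists j => i _.
  exact: nj.
(* The terms being 0 or 1 here, a sum below 1 means that quadric i causes no exception of weight
   1. *)
pose D := ([set i | (1 <= \sum_e a (inl (i, e)))%R] :|: [set h j | j : cell])%SET.
apply: (le_trans (b0_dominating_set R conn (D := D) _)).
  move=> i x pix; have [iD|iD] := boolP (i \in D); first by exists i => //; exists x.
  move: iD; rewrite !inE negb_or -ltNge => /andP[a_lt1 _].
  have no_exception e : exception_weight (inl (i, e)) = 1 ->
      ~ exception_event (inl (i, e)) t.
    move=> we et; move: a_lt1; rewrite (bigD1 e) //= /a we indicE mem_set //.
    rewrite mulr1 gtrDl ltNge => /negP; apply.
    by apply: sumr_ge0 => e' _; exact: a_ge0.
  have [j jy] : exists j : cell, in_cell step (corner rad j) (y i).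
    apply: grid_cover => // k; apply: contrapT => yk.
    by apply: (no_exception (inl k) erefl); rewrite /= in_itv.
  have jbox : exception_event (inl (i, inr j)) t.
    by move=> k _; rewrite /= /cell_itv /= in_itv /=; exact: jy.
  have jgood : j \notin bad_cells n rad K.
    by apply/negP => jbad; apply: (no_exception (inr j) _ jbox); rewrite /= jbad.
  have [z [z_iso q0] xz] := zero_locusP (yE i) pix.
  (* The cell is good and contains a form with a nonzero root; so it is not rootless and must be
     mixed. *)
  have jmixed : mixed fi gi step (corner rad j).
    apply: contrapT => nmixed; move: jgood; rewrite inE => /asboolPn; apply.
    by split=> // /(_ _ jy _ z_iso); rewrite q0 eqxx.
  exists (h j); first by rewrite !inE; apply/orP; right; apply/imsetP; exists j.
  have [||u [v [Zu Zv yu yv]]] := hub jmixed (y := y i) (z := y (h j)) => //.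
    by move=> k; exact: hP.
  exact: (zero_locus_meet (yE i) (yE (h j)) n_ge2 Zu Zv).
rewrite lee_fin; apply: (@le_trans _ _
  ((#|[set i | (1 <= \sum_e a (inl (i, e)))%R]%SET| + #|[set h j | j : cell]%SET|)%N%:R)).
  by rewrite ler_nat leq_card_setU.
rewrite natrD addrC lerD // ?ler_nat ?leq_imset_card //.
rewrite -[leRHS]/(\sum_e a e).
have -> : \sum_e a e = \sum_i \sum_e a (inl (i, e)) + \sum_j a (inr j).
  by rewrite big_sumType pair_bigA; congr (_ + _); apply: eq_bigr => -[].
rewrite -[leLHS]addr0 lerD // ?sumr_ge0 // -sum1_card natr_sum.
rewrite big_mkcond; apply: ler_sum => i _; rewrite inE.
by case: ifP => //; rewrite sumr_ge0.
Qed.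

Definition miss_prob (j : cell) : R :=
  1 - fine (\prod_k coef_prob k (hub_box j k))%E.

Lemma measurable_hub_box j k : measurable (hub_box j k).
Proof.
have -> : hub_box j k = `]z0 j k - eta j, z0 j k + eta j[%classic.
  by apply/seteqP; split=> x; rewrite /hub_box /= in_itv /= ltr_norml; lra.
exact: measurable_itv.
Qed.

Lemma measurable_exception_event e : measurable (exception_event e).
Proof.
case: e => [[i [k|j]]|j] /=.
- by rewrite -[X in measurable X]setTI; apply: measurable_coef => //;
    apply: measurableC.
- by apply: measurable_coef_box => // k; exact: measurable_itv.
- apply: fin_bigcap_measurable => [|i _]; first exact: finite_finset.
  by apply: measurableC; apply: measurable_coef_box => // k;
    exact: measurable_hub_box.
Qed.

(** The maximum of the joint density of the coefficients; times the volume of a cell it bounds the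
    probability of the cell. *)
Definition peak_prod : R := \prod_(k : I) normal_peak (coef_sd R k).

Hypothesis p_indep : independent_polys P p.

Lemma expected_b0_le (tau : R) : 0 <= tau ->
  (forall k : I, coef_prob k (~` `[(- rad)%R, rad[) <= tau%:E)%E ->
  (\int[P]_t b0 R (\bigcup_(i in [set: 'I_s]) zero_locus (p i t)) <=
   (#|{: cell}|%:R + s%:R * (#|{: I}|%:R * tau
     + #|bad_cells n rad K|%:R * (peak_prod * step ^+ #|{: I}|)
     + \sum_j miss_prob j ^+ s))%:E)%E.
Proof.
move=> tau_ge0 tail.
have step_ge0 : 0 <= step by rewrite divr_ge0 // ltW.
(* Bounds for the three kinds of events: a Gaussian tail, density times volume, and s independent
   misses. *)
pose v (e : exception) : R := match e with
  | inl (_, inl _) => tau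
  | inl (_, inr _) => peak_prod * step ^+ #|{: I}|
  | inr j => miss_prob j ^+ s
  end.
have vP e : (P (exception_event e) <= (v e)%:E)%E.
  case: e => [[i [k|j]]|j] /=.
  - rewrite (coef_distribution k (pK i)) //; exact: measurableC.
  - rewrite (coef_box_prob (pK i)) => [|k]; last exact: measurable_itv.
    rewrite /v.
    have -> : peak_prod * step ^+ #|{: I}| =
        \prod_(k : I) (normal_peak (coef_sd R k) * step).
      by rewrite big_split /= prodr_const.
    rewrite -prodEFin.
    apply: lee_prod => k; rewrite measure_ge0 /=.
    have := @normal_prob_itv_le R (coef_sd R k) (coef_sd_neq0 R k)
      (corner rad j k) (corner rad j k + step).
    rewrite lerDl => /(_ step_ge0).
    by have -> : corner rad j k + step - corner rad j k = step by ring.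
  - by rewrite (independent_coef_boxes_avoid pK p_indep (measurable_hub_box j)).
apply: (@le_trans _ _ ((#|{: cell}|%:R)%:E +
    \sum_e (exception_weight e)%:E * P (exception_event e))%E).
  apply: le_integral_sum_indic => //.
  - by move=> t; exact: b0_ge0.
  - by case=> [[i [k|j]]|j] /=.
  - exact: measurable_exception_event.
  - exact: b0_le_exceptions.
apply: (@le_trans _ _ (#|{: cell}|%:R%:E + \sum_e (exception_weight e * v e)%:E)%E).
  rewrite leeD2l //; apply: lee_sum => e _; rewrite EFinM lee_wpmul2l //.
  by rewrite lee_fin; case: e => [[i [k|j]]|j] /=.
rewrite sumEFin -EFinD lee_fin lerD2l big_sumType /= mulrDr lerD //; last first.
  by rewrite mulr_sumr.
rewrite (eq_bigr (fun ie => (fun (i : 'I_s) e =>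
  exception_weight (inl (i, e)) * v (inl (i, e))) ie.1 ie.2)); last by case.
rewrite -(pair_bigA _ (fun (i : 'I_s) e =>
  exception_weight (inl (i, e)) * v (inl (i, e)))) /=.
rewrite mulr_natl -[X in _ <= _ *+ X]card_ord -sumr_const; apply: ler_sum => i _.
rewrite big_sumType /= lerD //.
  by rewrite sumr_const mul1r mulr_natl.
have -> : #|bad_cells n rad K|%:R = \sum_j (j \in bad_cells n rad K)%:R :> R.
  rewrite -sum1_card natr_sum big_mkcond /=.
  by apply: eq_bigr => j _; case: (j \in _).
by rewrite mulr_suml.
Qed.

End PointwiseBound.

(** * Choice of the grid and asymptotic bound *)

Section Asymptotics.
Variables (R : realType) (n : nat).
Local Notation I := (quad_exponent n).
Local Notation fi := (@fst_index n).
Local Notation gi := (@snd_index n).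

(** The radius is fixed first, to make the tails small, and then K. There are O(K^(#|I| - 1)) bad
    cells, each of probability O(K^(- #|I|)), so together they contribute O(1/K). *)
Lemma fine_grid (eps : R) : 0 < eps -> exists (rad : R) (K : nat) (tau : R),
  [/\ 0 < rad, (0 < K)%N, 0 <= tau,
    (forall k : I, coef_prob k (~` `[(- rad)%R, rad[) <= tau%:E)%E &
    #|{: I}|%:R * tau + #|bad_cells n rad K|%:R
      * (peak_prod R n * (rad / K%:R) ^+ #|{: I}|) <= eps].
Proof.
move=> eps0; pose tau := eps / 2 / (#|{: I}|%:R + 1).
have I1_gt0 : 0 < #|{: I}|%:R + 1 :> R by rewrite ltr_wpDl.
have tau_gt0 : 0 < tau by rewrite !divr_gt0.
have tailP : \forall N \near \oo, forall k : I,
    (coef_prob k (~` `[(- N%:R)%R, N%:R%R[) <= tau%:E)%E.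
  by apply: filter_forall => k; apply: normal_prob_tail => //; exact: coef_sd_neq0.
have [N [Ntail N_gt0]] := filter_ex (filterI tailP (nbhs_infty_gt 0)).
pose rad : R := N%:R.
have rad_gt0 : 0 < rad by rewrite ltr0n.
have peak_gt0 : 0 < peak_prod R n.
  by apply: prodr_gt0 => k _; rewrite normal_peak_gt0 // coef_sd_neq0.
pose base : R := (2 + (2 * #|{: I}|).+1)%N%:R.
(* The bound of [card_bad_cells] times the bound on the probability of a cell gives C0 / K, which
   the choice of K makes at most eps / 2. *)
pose C0 := 2 * (base * rad) ^+ #|{: I}| * peak_prod R n.
have C0_ge0 : 0 <= C0.
  by rewrite !mulr_ge0 ?exprn_ge0 ?mulr_ge0 ?(ltW rad_gt0) ?(ltW peak_gt0).
pose K := (Num.truncn (2 * C0 / eps)).+1.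
have K_gt : 2 * C0 / eps < K%:R by exact: truncnS_gt.
have K0 : 0 < K%:R :> R by rewrite ltr0n.
exists rad, K, tau; split => //; first exact: ltW.
have -> : eps = eps / 2 + eps / 2 by lra.
apply: lerD.
  rewrite /tau mulrA ler_pdivrMr // mulrC ler_wpM2l ?divr_ge0 ?(ltW eps0) //.
  by rewrite lerDl.
apply: (@le_trans _ _ (C0 / K%:R)); last first.
  by rewrite ler_pdivrMr //; move: K_gt; rewrite ltr_pdivrMr //; lra.
rewrite ler_pdivlMr // expr_div_n /C0 exprMn.
have KI0 : 0 < K%:R ^+ #|{: I}| :> R by rewrite exprn_gt0.
have := card_bad_cells n rad_gt0 (isT : (0 < K)%N).
rewrite -(ler_nat R) !natrM natrX natrM exprMn -/base => badK.
have -> : #|bad_cells n rad K|%:R * (peak_prod R n * (rad ^+ #|{: I}| / K%:R ^+ #|{: I}|)) * K%:R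
  = #|bad_cells n rad K|%:R * K%:R * (peak_prod R n * rad ^+ #|{: I}| / K%:R ^+ #|{: I}|).
  by ring.
apply: (le_trans (ler_wpM2r _ badK)).
  by rewrite divr_ge0 ?mulr_ge0 ?exprn_ge0 ?ltW.
rewrite le_eqVlt; apply/orP; left; apply/eqP; field.
by rewrite gt_eqF.
Qed.

Lemma hubs_exist (rad : R) (K : nat) : 0 < rad -> (0 < K)%N ->
  exists (z0 : {ffun I -> 'I_(2 * K)} -> I -> R) (eta : {ffun I -> 'I_(2 * K)} -> R),
    (forall j, 0 < eta j) /\
    forall j, mixed fi gi (rad / K%:R) (corner rad j) ->
    forall y z, in_cell (rad / K%:R) (corner rad j) y ->
      (forall k, `|z k - z0 j k| < eta j) ->
    exists u v, [/\ isotropic fi gi z u, isotropic fi gi z v,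
      0 < qform fi gi y u & qform fi gi y v < 0].
Proof.
move=> rad_gt0 K_gt0.
have step_ge0 : 0 <= rad / K%:R by rewrite divr_ge0 // ltW.
have /choice[h hP] : forall j : {ffun I -> 'I_(2 * K)}, exists ze : (I -> R) * R,
    0 < ze.2 /\ (mixed fi gi (rad / K%:R) (corner rad j) ->
    forall y z, in_cell (rad / K%:R) (corner rad j) y ->
      (forall k, `|z k - ze.1 k| < ze.2) ->
    exists u v, [/\ isotropic fi gi z u, isotropic fi gi z v,
      0 < qform fi gi y u & qform fi gi y v < 0]).
  move=> j; have [jm|jm] := pselect (mixed fi gi (rad / K%:R) (corner rad j)).
    have [z0 [eta eta0 hub]] :=
      mixed_hub (@quad_exponent_monomials n) step_ge0 jm.
    by exists (z0, eta).
  (* A cell that is not mixed gets a dummy hub; its positive size still makes the probability of a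
     miss less than 1. *)
  by exists (fun=> 0, 1); split=> //=.
by exists (fun j => (h j).1), (fun j => (h j).2); split=> j; have [] := hP j.
Qed.

Lemma miss_prob_itv K (z0 : {ffun I -> 'I_(2 * K)} -> I -> R) eta j :
  0 < eta j -> 0 <= miss_prob z0 eta j < 1.
Proof.
move=> eta0; rewrite /miss_prob.
have box_fin k : coef_prob k (hub_box z0 eta j k) =
    (fine (coef_prob k (hub_box z0 eta j k)))%:E.
  rewrite fineK //; apply: (@fin_num_measure _ _ R (normal_prob (0 : R) (coef_sd R k))).
  exact: measurable_hub_box.
have box_le1 k : fine (coef_prob k (hub_box z0 eta j k)) <= 1.
  rewrite -lee_fin -box_fin.
  apply: (@probability_le1 _ _ R (normal_prob (0 : R) (coef_sd R k))).
  exact: measurable_hub_box.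
have box_gt0 k : 0 < fine (coef_prob k (hub_box z0 eta j k)).
  rewrite -lte_fin -box_fin.
  exact: (normal_prob_itv_gt0 (coef_sd_neq0 R k) (z0 j k) eta0).
rewrite (eq_bigr (fun k => (fine (coef_prob k (hub_box z0 eta j k)))%:E)) //.
rewrite prodEFin /= subr_ge0 ltrBlDr ltrDl; apply/andP; split.
  by apply: prodr_ile1 => k _; rewrite box_le1 ltW.
exact: prodr_gt0.
Qed.

Lemma cvg_sum_expr (J : finType) (q : J -> R) : (forall j, 0 <= q j < 1) ->
  (fun s => \sum_j q j ^+ s) @ \oo --> (0 : R).
Proof.
move=> q01.
have -> : (fun s => \sum_j q j ^+ s) = \sum_j (fun s => q j ^+ s).
  by apply/funext => s; rewrite fct_sumE.
apply: (big_ind (fun u : nat -> R => u @ \oo --> (0 : R))).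
- exact: cvg_cst.
- by move=> u v u0 v0; rewrite -[X in _ --> X](addr0 0); exact: cvgD.
- move=> j _; apply: cvg_expr; have /andP[q0 q1] := q01 j.
  by rewrite ger0_norm.
Qed.

(** M and u are chosen before s and the probability space, because in the theorem the space varies
    with s. *)
Lemma expected_b0_asymptotic (eps : R) : (2 <= n)%N -> 0 < eps ->
  exists (M : R) (u : nat -> R), [/\ 0 <= M, u @ \oo --> (0 : R) &
  forall (s : nat) (d : measure_display) (T : measurableType d)
    (P : probability T R) (p : 'I_s -> T -> mpoly.mpoly n.+1 R),
    (forall i, kostlan P 2 (p i)) -> independent_polys P p ->
    (\int[P]_t b0 R (\bigcup_(i in [set: 'I_s]) zero_locus (p i t)) <=
     (M + s%:R * (eps + u s))%:E)%E].
Proof.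
move=> n_ge2 /fine_grid[rad [K [tau [rad_gt0 K_gt0 tau_ge0 tail small]]]].
have [z0 [eta [eta0 hub]]] := hubs_exist rad_gt0 K_gt0.
exists #|{: {ffun I -> 'I_(2 * K)}}|%:R,
  (fun s => \sum_j miss_prob z0 eta j ^+ s); split=> //.
  by apply: cvg_sum_expr => j; exact: miss_prob_itv.
move=> s d T P p pK p_indep.
apply: (le_trans (expected_b0_le n_ge2 rad_gt0 K_gt0 hub pK p_indep tau_ge0 tail)).
by rewrite lee_fin lerD2l ler_wpM2l // lerD2r.
Qed.

End Asymptotics.

(** * Passage to the limit *)

Theorem theorem2 (R : realType) (n : nat) (hn : (2 <= n)%N)
    (disp : nat -> measure_display) (T : forall s, measurableType (disp s))
    (P : forall s, probability (T s) R)
    (p : forall s, 'I_s -> T s -> mpoly.mpoly n.+1 R)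
    (hkostlan : forall s (i : 'I_s), kostlan (P s) 2 (p s i))
    (hindep : forall s, independent_polys (P s) (p s)) :
  (fun s : nat =>
     ((\int[P s]_t b0 R (\bigcup_(i in [set: 'I_s]) zero_locus (p s i t)))
        / s%:R%:E)%E) @ \oo --> 0%E.
Proof.
pose E s :=
  (\int[P s]_t b0 R (\bigcup_(i in [set: 'I_s]) zero_locus (p s i t)))%E.
rewrite -[X in X @ _]/(fun s : nat => E s / s%:R%:E)%E.
have E_ge0 s : (0 <= E s)%E by apply: integral_ge0 => t _; exact: b0_ge0.
have sE s (r : R) : (0 < s)%N -> (E s <= (s%:R * r)%:E)%E ->
    (E s / s%:R%:E <= r%:E)%E.
  move=> s_gt0 Esr; rewrite inver pnatr_eq0 -leqn0 leqNgt s_gt0 /=.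
  have -> : r%:E = ((s%:R * r)%:E * (s%:R^-1)%:E)%E.
    by rewrite -EFinM mulrAC divff ?mul1r // pnatr_eq0 -lt0n.
  by rewrite lee_wpmul2r // lee_fin invr_ge0.
have small eps : 0 < eps -> \forall s \near \oo, (E s / s%:R%:E <= eps%:E)%E.
  (* One third of eps each for M / s, for the grid error and for u(s). *)
  move=> eps0; have [|M [u [M_ge0 u0 EM]]] := @expected_b0_asymptotic R n (eps / 3) hn.
    by rewrite divr_gt0.
  near=> s; apply: sE; first by near: s; exact: nbhs_infty_gt.
  apply: (le_trans (EM s _ _ _ _ (hkostlan s) (hindep s))); rewrite lee_fin.
  have us : u s <= eps / 3.
    by near: s; apply: (@cvgr_le _ _ _ _ _ _ u0); rewrite divr_gt0.
  have Ms : M <= s%:R * (eps / 3).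
    rewrite -ler_pdivrMr ?divr_gt0 //; near: s; exact: nbhs_infty_ger.
  have : s%:R * u s <= s%:R * (eps / 3) by rewrite ler_wpM2l.
  by rewrite mulrDr; lra.
have pos s : (0 < s)%N -> (0 <= E s / s%:R%:E)%E.
  by move=> s_gt0; rewrite mule_ge0 // inve_ge0.
(* A finite limit in the extended reals means finite values from some s on and convergence of their
   real parts. *)
apply/fine_cvgP; split.
  near=> s; rewrite ge0_fin_numE; last by apply: pos; near: s; exact: nbhs_infty_gt.
  apply: (@le_lt_trans _ _ 1%:E%E); last exact: ltry.
  by near: s; exact: small.
apply/cvgrPdist_le => eps eps0; near=> s; rewrite sub0r normrN /=.
have s_small : (E s / s%:R%:E <= eps%:E)%E by near: s; exact: small.
have s_pos : (0 <= E s / s%:R%:E)%E by apply: pos; near: s; exact: nbhs_infty_gt.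
rewrite ger0_norm ?fine_ge0 // -lee_fin fineK // ge0_fin_numE //.
exact: le_lt_trans s_small (ltry _).
Unshelve. all: by end_near.
Qed.
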